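(* For any interval exchange $f\in\mathcal{E}$, either $d(f^n)$ exhibits linear growth in $n$ or $d(f^n)$ is bounded independently of $n$.
   Context: Identify $\mathbb{T}^1=\mathbb{R}/\mathbb{Z}$ with $[0,1)$. An interval exchange transformation is a bijection of $\mathbb{T}^1$ that is a translation on each piece of some partition of $[0,1)$ into finitely many half-open intervals $[a,b)$; $\mathcal{E}$ is the group of these. $d(g)$ is the number of points at which $g$ is discontinuous as a map $\mathbb{T}^1\to\mathbb{T}^1$ with the standard circle topology. Linear growth means there is $c>0$ with $d(f^n)\ge c|n|$ for all sufficiently large $|n|$ (one always has $d(f^n)\le d(f)|n|$). *)

(* Defs.v *)
From Stdlib Require Import Reals Lra ZArith List.
Open Scope R_scope.

(* The circle T^1 = R/Z is identified with [0,1); maps are R -> R and only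
   their values on [0,1) matter. *)
Definition unit_int (x : R) : Prop := 0 <= x < 1.

Definition cdist (x y : R) : R :=
  Rmin (frac_part (x - y)) (1 - frac_part (x - y)).

Definition is_IET (f : R -> R) : Prop :=
  (forall x, unit_int x -> unit_int (f x)) /\
  (forall x y, unit_int x -> unit_int y -> f x = f y -> x = y) /\
  (forall y, unit_int y -> exists x, unit_int x /\ f x = y) /\
  exists (k : nat) (a t : nat -> R),
    a 0%nat = 0 /\ a k = 1 /\
    (forall i, (i < k)%nat -> a i < a (S i)) /\
    (forall i x, (i < k)%nat -> a i <= x < a (S i) -> f x = x + t i).

Definition circ_continuous_at (g : R -> R) (p : R) : Prop :=
  forall eps, 0 < eps -> exists delta, 0 < delta /\
    forall x, unit_int x -> cdist x p < delta -> cdist (g x) (g p) < eps.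

Definition disc_count (g : R -> R) (m : nat) : Prop :=
  exists l : list R, NoDup l /\ length l = m /\
    forall p, In p l <-> (unit_int p /\ ~ circ_continuous_at g p).

Fixpoint iter (h : R -> R) (n : nat) (x : R) : R :=
  match n with O => x | S n' => h (iter h n' x) end.

Definition zpow (f finv : R -> R) (n : Z) : R -> R :=
  match n with
  | Z0 => fun x => x
  | Zpos p => iter f (Pos.to_nat p)
  | Zneg p => iter finv (Pos.to_nat p)
  end.

(* Main.v *)
(** An interval exchange [f] is right-continuous and has a left limit [h p] at
    every point [p] of the circle.  The map [h] is again a bijection, the left
    limits of [f^n] are given by [h^n], and so [d (f^n)] counts the points with
    [f^n p <> h^n p].  Now [f] and [h] differ only on a finite set [D].  A
    disagreement at [p] starts when the orbit of [p] first enters [D], say at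
    [q].  If the backward orbit of [q] returns to [D], then [q] accounts for
    boundedly many [p], uniformly in [n].  Otherwise the orbits of [q] under [f]
    and [h] are infinite, finally leave [D], and from then on stay equal (a
    bounded contribution) or stay distinct (a contribution of at least [n - M]).
    Negative powers have the same count, [f^n] mapping the disagreements of
    [f^n] and [h^n] onto those of [f^-n] and [h^-n]. *)

From Stdlib Require Import Reals ZArith List Lra Lia Classical ClassicalEpsilon.
Require Import Defs.
Open Scope R_scope.

(** * Iterates *)

Lemma iter_add (g : R -> R) (m n : nat) (x : R) :
  iter g (m + n) x = iter g m (iter g n x).
Proof. induction m as [|m IH]; simpl; [reflexivity | now rewrite IH]. Qed.

Lemma iter_shift (g : R -> R) (n : nat) (x : R) : iter g n (g x) = g (iter g n x).
Proof. induction n as [|n IH]; simpl; [reflexivity | now rewrite IH]. Qed.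

Lemma iter_cancel (f g : R -> R) (n : nat) (x : R) :
  (forall y, g (f y) = y) -> iter g n (iter f n x) = x.
Proof.
  intros gf; revert x; induction n as [|n IH]; intros x; simpl; [reflexivity|].
  now rewrite <- iter_shift, gf.
Qed.

Lemma iter_cancel_le (f g : R -> R) (k n : nat) (x : R) :
  (forall y, g (f y) = y) -> (k <= n)%nat ->
  iter g n (iter f k x) = iter g (n - k) x.
Proof.
  intros gf le_kn; replace n with ((n - k) + k)%nat at 1 by lia.
  now rewrite iter_add, iter_cancel.
Qed.

Lemma iter_inj (g : R -> R) (n : nat) (x y : R) :
  (forall u v, g u = g v -> u = v) -> iter g n x = iter g n y -> x = y.
Proof. intros inj; induction n as [|n IH]; simpl; auto. Qed.

Lemma first_hit (u : nat -> R) (D : list R) (n : nat) :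
  (forall j, (j < n)%nat -> ~ In (u j) D) \/
  exists k, (k < n)%nat /\ In (u k) D /\ forall j, (j < k)%nat -> ~ In (u j) D.
Proof.
  induction n as [|n [none | (k & lt_kn & hit)]].
  - left; intros j lt_j; lia.
  - destruct (in_dec Req_dec_T (u n) D) as [hit | miss].
    + right; exists n; auto.
    + left; intros j lt_j. assert (j = n \/ j < n)%nat as [-> | lt] by lia; auto.
  - right; exists k; split; [lia | exact hit].
Qed.

Lemma injective_seq_leaves_list (u : nat -> R) (D : list R) :
  (forall i j, u i = u j -> i = j) ->
  exists M, forall m, (M <= m)%nat -> ~ In (u m) D.
Proof.
  intros inj; induction D as [|d D [M leave]].
  - exists 0%nat; simpl; tauto.
  - destruct (classic (exists i, u i = d)) as [[i ui] | none].
    + exists (S (Nat.max i M)); intros m le_m [um | um].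
      * assert (i = m) by (apply inj; congruence); lia.
      * apply (leave m); [lia | exact um].
    + exists M; intros m le_m [um | um]; [apply none; eauto | now apply (leave m)].
Qed.

(** Turns thresholds that depend on the point of [D] into one common threshold, which makes the
    final bound uniform. *)
Lemma uniform_threshold (P : R -> nat -> Prop) (D : list R) :
  (forall q m m', (m <= m')%nat -> P q m -> P q m') ->
  (forall q, In q D -> exists m, P q m) ->
  exists M, forall q, In q D -> P q M.
Proof.
  intros mono; induction D as [|d D IH]; intros ex.
  - exists 0%nat; intros q [].
  - destruct IH as [M HM]; [intros q Hq; apply ex; now right|].
    destruct (ex d) as [m Hm]; [now left|].
    exists (Nat.max m M); intros q [<- | Hq].
    + apply (mono d m); [lia | exact Hm].
    + apply (mono q M); [lia | auto].
Qed.

(** * Two bijections differing at finitely many points *)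

Section FinitelyManyDisagreements.

(** In the application [f] is the exchange, [g] its inverse and [h] its left-limit map; the argument
    here is purely combinatorial. *)
Context (f g h : R -> R) (D : list R).
Context (gf : forall x, g (f x) = x) (fg : forall x, f (g x) = x).
Context (h_inj : forall x y, h x = h y -> x = y).
Context (D_spec : forall x, In x D <-> f x <> h x).

Let f_inj (x y : R) : f x = f y -> x = y.
Proof. intros eq; rewrite <- (gf x), eq; apply gf. Qed.

Lemma eq_off_D (x : R) : ~ In x D -> h x = f x.
Proof. rewrite D_spec; intros H; apply NNPP in H; congruence. Qed.

Lemma iter_eq_avoiding_D (n : nat) (x : R) :
  (forall j, (j < n)%nat -> ~ In (iter f j x) D) -> iter h n x = iter f n x.
Proof.
  induction n as [|n IH]; intros avoid; simpl; [reflexivity|].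
  rewrite IH by auto. apply eq_off_D; auto.
Qed.

(** Take [q] to be the first point of the [f]-orbit of [x] in [D]. Up to [q] both maps follow the
    same path, so the disagreement is that of the remaining [n - k] steps from [q]. Pulling every
    disagreement back to the finite set [D] makes counting possible. *)
Lemma disagreement_origin (n : nat) (x : R) :
  iter f n x <> iter h n x ->
  exists k q, (k < n)%nat /\ In q D /\ x = iter g k q /\
    (forall j, (1 <= j <= k)%nat -> ~ In (iter g j q) D) /\
    iter f (n - k) q <> iter h (n - k) q.
Proof.
  intros neq. destruct (first_hit (fun j => iter f j x) D n)
    as [none | (k & lt_kn & hit & first)].
  - now rewrite iter_eq_avoiding_D in neq.
  - exists k, (iter f k x); repeat split; auto.
    + now rewrite iter_cancel.
    + intros j Hj. replace k with (j + (k - j))%nat by lia.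
      rewrite iter_add, iter_cancel by auto. apply first; lia.
    + replace n with ((n - k) + k)%nat in neq by lia.
      rewrite !iter_add in neq. now rewrite (iter_eq_avoiding_D k) in neq.
Qed.

(** * Points of [D] whose backward orbit never returns to [D] *)

Section NonReturning.

Context (q : R) (q_in : In q D).
Context (no_return : forall j, (1 <= j)%nat -> ~ In (iter g j q) D).

Lemma iter_f_past (n k : nat) : (k <= n)%nat -> iter f n (iter g k q) = iter f (n - k) q.
Proof. intros le; now apply iter_cancel_le. Qed.

Lemma iter_h_past (n k : nat) : (k <= n)%nat -> iter h n (iter g k q) = iter h (n - k) q.
Proof.
  intros le. replace n with ((n - k) + k)%nat at 1 by lia.
  rewrite iter_add, (iter_eq_avoiding_D k).
  - now rewrite iter_cancel.
  - intros j lt_j. replace k with (j + (k - j))%nat by lia.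
    rewrite iter_add, iter_cancel by auto. apply no_return; lia.
Qed.

Lemma past_ne (j : nat) : (1 <= j)%nat -> iter g j q <> q.
Proof. intros le eq; apply (no_return j le); now rewrite eq. Qed.

(** A coincidence would make [q] periodic under [g], hence a return to [q], which lies in [D]. *)
Lemma past_injective (i j : nat) : iter g i q = iter g j q -> i = j.
Proof.
  assert (lt_case : forall i j, (i < j)%nat -> iter g i q <> iter g j q).
  { intros a b lt eq. apply (past_ne (b - a)); [lia|].
    rewrite <- (iter_cancel g f a q fg) at 2. rewrite eq.
    replace b with (a + (b - a))%nat at 2 by lia.
    now rewrite iter_add, iter_cancel. }
  intros eq. destruct (Nat.lt_total i j) as [lt | [-> | lt]]; auto;
    exfalso; eapply lt_case; eauto.
Qed.

(** If [e^a q = e^b q] with [a < b], cancelling gives [q = e^(b-a) q]. Since also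
    [e^(b-a) (g^(b-a) q) = q], injectivity yields [g^(b-a) q = q], a return. It is applied to
    [e = h], which follows [f] along the backward orbit of [q]. *)
Lemma future_injective (e : R -> R) :
  (forall x y, e x = e y -> x = y) ->
  (forall k, iter e k (iter g k q) = q) ->
  forall i j, iter e i q = iter e j q -> i = j.
Proof.
  intros e_inj past.
  assert (lt_case : forall i j, (i < j)%nat -> iter e i q <> iter e j q).
  { intros a b lt eq. apply (past_ne (b - a)); [lia|].
    apply (iter_inj e (b - a)); [exact e_inj|]. rewrite past.
    apply (iter_inj e a); [exact e_inj|].
    rewrite <- iter_add. now replace (a + (b - a))%nat with b by lia. }
  intros i j eq. destruct (Nat.lt_total i j) as [lt | [-> | lt]]; auto;
    exfalso; eapply lt_case; eauto.
Qed.

(* Both forward orbits eventually leave D for good; from then on f and h move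
   them by the same injective map, so they stay equal or stay distinct. *)
Lemma eventually_equal_or_distinct :
  exists M, (forall m, (M <= m)%nat -> iter f m q <> iter h m q) \/
            (forall m, (M <= m)%nat -> iter f m q = iter h m q).
Proof.
  destruct (injective_seq_leaves_list (fun m => iter h m q) D) as [M leave].
  { apply future_injective; auto. intros k. rewrite iter_h_past by lia.
    now rewrite Nat.sub_diag. }
  exists M.
  assert (step : forall d, iter f (d + M) q = iter h (d + M) q <-> iter f M q = iter h M q).
  { induction d as [|d IH]; [tauto|]. rewrite <- IH; simpl.
    rewrite (eq_off_D (iter h (d + M) q)) by (apply leave; lia).
    split; [apply f_inj | congruence]. }
  destruct (classic (iter f M q = iter h M q)) as [eq | neq]; [right | left];
    intros m le; replace m with ((m - M) + M)%nat by lia; rewrite step; assumption.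
Qed.

End NonReturning.

(** * Counting the disagreements of iterates *)

Lemma disagreements_finite (n : nat) :
  exists l, NoDup l /\ forall x, In x l <-> iter f n x <> iter h n x.
Proof.
  (* By [disagreement_origin], each disagreement is some [g^k q] with [k < n] and [q] in [D]. *)
  set (cands := map (fun p => iter g (fst p) (snd p)) (list_prod (seq 0 n) D)).
  set (test := fun x => if Req_dec_T (iter f n x) (iter h n x) then false else true).
  exists (nodup Req_dec_T (filter test cands)); split; [apply NoDup_nodup|].
  intros x. rewrite nodup_In, filter_In; unfold test.
  destruct (Req_dec_T (iter f n x) (iter h n x)) as [eq | neq].
  - split; [intros [_ H]; discriminate H | tauto].
  - split; [tauto | intros _; split; [|reflexivity]].
    destruct (disagreement_origin n x neq) as (k & q & lt & q_in & -> & _).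
    apply in_map_iff; exists (k, q); split; [reflexivity|].
    apply in_prod; [apply in_seq; lia | exact q_in].
Qed.

Lemma disagreements_linear_or_bounded :
  (exists M, forall n l, (M <= n)%nat ->
     (forall x, In x l <-> iter f n x <> iter h n x) -> (n - M <= length l)%nat) \/
  (exists B, forall n l, NoDup l ->
     (forall x, In x l <-> iter f n x <> iter h n x) -> (length l <= B)%nat).
Proof.
  destruct (classic (exists q M, In q D /\
    (forall j, (1 <= j)%nat -> ~ In (iter g j q) D) /\
    (forall m, (M <= m)%nat -> iter f m q <> iter h m q)))
    as [(q & M & q_in & no_return & distinct) | none].
  - left; exists M; intros n l le l_spec.
    (* The points [g^k q] with [k < n - M] are distinct, and each is a disagreement because [n - k]
       steps lead it past time [M] of the orbits of [q]. *)
    rewrite <- (length_seq (n - M) 0), <- (length_map (fun k => iter g k q)).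
    apply NoDup_incl_length.
    + apply NoDup_map_NoDup_ForallPairs; [|apply seq_NoDup].
      intros i j _ _; now apply past_injective.
    + intros x Hx; apply in_map_iff in Hx as (k & <- & Hk); apply in_seq in Hk.
      apply l_spec. rewrite iter_f_past, iter_h_past by (auto; lia).
      apply distinct; lia.
  - right.
    destruct (uniform_threshold (fun q M =>
        (exists j, (1 <= j <= M)%nat /\ In (iter g j q) D) \/
        (forall m, (M <= m)%nat -> iter f m q = iter h m q)) D) as [M HM].
    { intros q m m' le [(j & Hj & hit) | eq]; [left; exists j; split; [lia|auto]|].
      right; intros; apply eq; lia. }
    { intros q q_in.
      destruct (classic (exists j, (1 <= j)%nat /\ In (iter g j q) D))
        as [(j & Hj & hit) | no_return].
      - exists j; left; exists j; split; [lia|auto].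
      - assert (nr : forall j, (1 <= j)%nat -> ~ In (iter g j q) D)
          by (intros j Hj hit; apply no_return; eauto).
        destruct (eventually_equal_or_distinct q q_in nr) as (M & [neq | eq]).
        + exfalso; apply none; exists q, M; auto.
        + exists M; auto. }
    (* A disagreement [x = g^k q] has [k < M] if the backward orbit of [q] returns to [D] within [M]
       steps, since [q] is the first hit of [x]. It has [n - k < M] if the forward orbits of [q]
       coincide from time [M] on. Each kind has at most [M] times the length of [D] members. *)
    exists (length (list_prod (seq 0 M) D) + length (list_prod (seq 0 M) D))%nat.
    intros n l l_nodup l_spec.
    set (recent := map (fun p => iter g (fst p) (snd p)) (list_prod (seq 0 M) D)).
    set (old := map (fun p => iter g (n - fst p) (snd p)) (list_prod (seq 0 M) D)).
    replace (_ + _)%nat with (length (recent ++ old))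
      by (unfold recent, old; now rewrite length_app, !length_map).
    apply NoDup_incl_length; [exact l_nodup|].
    intros x Hx; apply l_spec in Hx.
    destruct (disagreement_origin n x Hx) as (k & q & lt & q_in & -> & first & neq).
    apply in_or_app. destruct (HM q q_in) as [(j & Hj & hit) | eq].
    + left; apply in_map_iff; exists (k, q); split; [reflexivity|].
      apply in_prod; [apply in_seq | exact q_in].
      destruct (Nat.lt_ge_cases k j); [lia | exfalso; apply (first j); [lia|auto]].
    + right; apply in_map_iff; exists ((n - k)%nat, q); simpl.
      split; [f_equal; lia|]. apply in_prod; [apply in_seq | exact q_in].
      destruct (Nat.lt_ge_cases (n - k) M); [lia | exfalso; apply neq, eq; auto].
Qed.

(** Being injective and equal to [f] off [D], [h] maps [D] into [f D]; these sets have the same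
    finite size, so [h D = f D]. *)
Lemma h_surjective (y : R) : NoDup D -> exists x, h x = y.
Proof.
  intros nd. destruct (in_dec Req_dec_T (g y) D) as [q_in | q_out].
  - assert (sub : incl (map f D) (map h D)).
    { apply NoDup_length_incl.
      - apply NoDup_map_NoDup_ForallPairs; auto. intros a b _ _; apply h_inj.
      - now rewrite !length_map.
      - intros z Hz; apply in_map_iff in Hz as (p & <- & Hp).
        destruct (in_dec Req_dec_T (g (h p)) D) as [r_in | r_out].
        + apply in_map_iff; exists (g (h p)); auto.
        (* With [r = g (h p)] off [D], [h r = f r = h p] forces [r = p], which is in [D]. *)
        + exfalso; apply r_out. apply eq_off_D in r_out; rewrite fg in r_out.
          apply h_inj in r_out; now rewrite r_out. }
    destruct (proj1 (in_map_iff h D y)) as (x & Hx & _); [|now exists x].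
    apply sub, in_map_iff; exists (g y); auto.
  - exists (g y); rewrite (eq_off_D _ q_out); apply fg.
Qed.

End FinitelyManyDisagreements.

(** If [f^n] and [h^n] send [x] to the same [y], then [g^n] and [k^n] both send [y] back to [x], and
    conversely. Hence the bijection [f^n] matches agreements with agreements, and so disagreements
    with disagreements. *)
Lemma disagreements_inverse (f g h k : R -> R) (n : nat) (l : list R) :
  (forall x, g (f x) = x) -> (forall x, f (g x) = x) ->
  (forall x, k (h x) = x) -> (forall x, h (k x) = x) -> NoDup l ->
  (forall x, In x l <-> iter f n x <> iter h n x) ->
  exists l', NoDup l' /\ length l' = length l /\
    forall y, In y l' <-> iter g n y <> iter k n y.
Proof.
  intros gf fg kh hk nd l_spec. exists (map (iter f n) l); split; [|split].
  - apply NoDup_map_NoDup_ForallPairs; auto. intros a b _ _ eq.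
    now rewrite <- (iter_cancel f g n a gf), eq, iter_cancel.
  - apply length_map.
  - intros y; rewrite in_map_iff; split.
    + intros (x & <- & Hx); apply l_spec in Hx; rewrite iter_cancel by auto.
      intros eq; apply Hx; rewrite eq at 2; now rewrite iter_cancel.
    + intros neq; exists (iter g n y); rewrite iter_cancel by auto; split; [auto|].
      apply l_spec; rewrite iter_cancel by auto. intros eq; apply neq.
      rewrite eq at 2; now rewrite iter_cancel.
Qed.

(** * One-sided germs on the circle *)

Lemma frac_part_unique (k : Z) (x z : R) : unit_int z -> x = IZR k + z -> frac_part x = z.
Proof. intros Hz Hx; symmetry; exact (proj2 (Int_part_frac_part_spec x k z Hz Hx)). Qed.

Lemma frac_part_unit (x : R) : unit_int x -> frac_part x = x.
Proof. intros Hx; apply (frac_part_unique 0); [exact Hx | lra]. Qed.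

Lemma unit_frac_part (x : R) : unit_int (frac_part x).
Proof. destruct (base_fp x); split; lra. Qed.

Lemma frac_part_add_frac_part (x a : R) : frac_part (frac_part x + a) = frac_part (x + a).
Proof.
  symmetry; apply (frac_part_unique (Int_part x + Int_part (frac_part x + a))).
  - apply unit_frac_part.
  - rewrite plus_IZR. pose proof (Rplus_Int_part_frac_part x).
    pose proof (Rplus_Int_part_frac_part (frac_part x + a)). lra.
Qed.

Lemma frac_part_add_inj (x y a : R) :
  unit_int x -> unit_int y -> frac_part (x + a) = frac_part (y + a) -> x = y.
Proof.
  intros Hx Hy eq. rewrite <- (frac_part_unit x Hx), <- (frac_part_unit y Hy).
  replace x with ((x + a) + - a) by ring; replace y with ((y + a) + - a) by ring.
  now rewrite <- frac_part_add_frac_part, eq, frac_part_add_frac_part.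
Qed.

(* For [e = 1] (resp. [e = -1]): just to the right (resp. left) of [p], the map
   [g] is a translation of the circle carrying [p] to [y]. *)
Definition germ (e : R) (g : R -> R) (p y : R) : Prop :=
  exists d, 0 < d /\
    forall s, 0 < s < d -> g (frac_part (p + e * s)) = frac_part (y + e * s).

Lemma germ_comp (e : R) (f g : R -> R) (p y z : R) :
  germ e g p y -> germ e f y z -> germ e (fun x => f (g x)) p z.
Proof.
  intros (d & Hd & Hg) (d' & Hd' & Hf). exists (Rmin d d'); split.
  - now apply Rmin_glb_lt.
  - intros s Hs. pose proof (Rmin_l d d'). pose proof (Rmin_r d d').
    rewrite Hg by lra. apply Hf; lra.
Qed.

Lemma germ_inverse (e : R) (f g : R -> R) (p y : R) :
  (forall x, g (f x) = x) -> germ e f p y -> germ e g y p.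
Proof. intros gf (d & Hd & Hf). exists d; split; auto. intros s Hs; now rewrite <- Hf. Qed.

Lemma germ_unique (e : R) (g : R -> R) (p y z : R) :
  unit_int y -> unit_int z -> germ e g p y -> germ e g p z -> y = z.
Proof.
  intros Hy Hz (d & Hd & Hg) (d' & Hd' & Hg').
  pose proof (Rmin_l d d'). pose proof (Rmin_r d d').
  pose proof (Rmin_glb_lt d d' 0 Hd Hd').
  apply (frac_part_add_inj y z (e * (Rmin d d' / 2))); auto.
  rewrite <- Hg, <- Hg' by lra. reflexivity.
Qed.

Lemma cdist_frac_part (x p : R) : cdist (frac_part x) p = cdist x p.
Proof. unfold cdist, Rminus at 1 3. now rewrite frac_part_add_frac_part. Qed.

Lemma cdist_right (p s : R) : 0 <= s < 1 -> cdist (p + s) p <= s.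
Proof.
  intros Hs; unfold cdist. replace (p + s - p) with s by ring.
  rewrite frac_part_unit by exact Hs. apply Rmin_l.
Qed.

Lemma cdist_left (p s : R) : 0 < s < 1 -> cdist (p + -1 * s) p <= s.
Proof.
  intros Hs; unfold cdist. rewrite (frac_part_unique (-1) _ (1 - s)).
  - eapply Rle_trans; [apply Rmin_r | lra].
  - split; lra.
  - lra.
Qed.

Lemma near_cases (x p d : R) :
  unit_int x -> unit_int p -> cdist x p < d ->
  x = p \/ exists s, 0 < s < d /\ s < 1 /\
    (x = frac_part (p + 1 * s) \/ x = frac_part (p + -1 * s)).
Proof.
  intros Hx Hp near.
  pose proof (unit_frac_part (x - p)) as [H0 H1].
  pose proof (Rplus_Int_part_frac_part (x - p)) as Hint.
  (* [r] and [1 - r] are the lengths of the arcs from [p] to [x], rightwards and leftwards;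
     [cdist x p] is the smaller. *)
  set (r := frac_part (x - p)) in *.
  assert (right : frac_part (p + r) = x).
  { apply (frac_part_unique (- Int_part (x - p))); auto. rewrite opp_IZR; lra. }
  assert (left : frac_part (p + -1 * (1 - r)) = x).
  { apply (frac_part_unique (- Int_part (x - p) - 1)); auto.
    rewrite minus_IZR, opp_IZR; lra. }
  destruct (Req_dec_T r 0) as [r0 | r0].
  - left. rewrite r0, Rplus_0_r, frac_part_unit in right; auto.
  - right. unfold cdist in near; fold r in near.
    unfold Rmin in near; destruct Rle_dec.
    + exists r; rewrite Rmult_1_l; repeat split; try lra; auto.
    + exists (1 - r); repeat split; try lra; auto.
Qed.

Lemma continuous_iff_left_germ (g : R -> R) (p y : R) :
  unit_int p -> unit_int (g p) -> unit_int y ->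
  germ 1 g p (g p) -> germ (-1) g p y ->
  (circ_continuous_at g p <-> g p = y).
Proof.
  intros Hp Hgp Hy (d & Hd & right) (d' & Hd' & left); split.
  - intros cont. apply NNPP; intros neq.
    (* [r] is the circle distance from [y] to [g p], travelling leftwards. *)
    assert (exists r (k : Z), 0 < r < 1 /\ y - g p = r + IZR k) as (r & k & Hr & Hk).
    { destruct Hy, Hgp, (Rtotal_order y (g p)) as [lt | [eq | gt]]; [| congruence |].
      - exists (y - g p + 1), (-1)%Z; lra.
      - exists (y - g p), 0%Z; lra. }
    (* For [s < r / 2] the point [p - s] goes to [y - s], and the two arcs between [y - s] and [g p]
       have lengths [r - s > r / 2] and [1 - r + s > 1 - r]. So this minimum serves as the [eps]
       that refutes continuity. *)
    pose proof (Rmin_l (r / 2) (1 - r)). pose proof (Rmin_r (r / 2) (1 - r)).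
    assert (0 < Rmin (r / 2) (1 - r)) by (apply Rmin_glb_lt; lra).
    destruct (cont (Rmin (r / 2) (1 - r))) as (delta & Hdelta & close); auto.
    assert (exists s, 0 < s /\ s < d' /\ s < delta /\ s < r / 2 /\ s < 1)
      as (s & s0 & s1 & s2 & s3 & s4).
    { pose proof (Rmin_l d' delta). pose proof (Rmin_r d' delta).
      pose proof (Rmin_l (Rmin d' delta) (r / 2)). pose proof (Rmin_r (Rmin d' delta) (r / 2)).
      assert (0 < Rmin (Rmin d' delta) (r / 2)) by (repeat apply Rmin_glb_lt; lra).
      exists (Rmin (Rmin d' delta) (r / 2) / 2); lra. }
    specialize (close (frac_part (p + -1 * s)) (unit_frac_part _)).
    rewrite cdist_frac_part, left, cdist_frac_part in close by lra.
    assert (near : cdist (p + -1 * s) p < delta)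
      by (eapply Rle_lt_trans; [apply cdist_left; lra | lra]).
    specialize (close near). unfold cdist in close.
    rewrite (frac_part_unique k _ (r - s)) in close by (unfold unit_int; lra).
    unfold Rmin at 1 in close; destruct Rle_dec; lra.
  - intros <- eps Heps.
    exists (Rmin eps (Rmin d d')); split; [repeat apply Rmin_glb_lt; auto|].
    pose proof (Rmin_l eps (Rmin d d')). pose proof (Rmin_r eps (Rmin d d')).
    pose proof (Rmin_l d d'). pose proof (Rmin_r d d').
    intros x Hx near.
    destruct (near_cases x p _ Hx Hp near) as [-> | (s & Hs & s1 & [-> | ->])].
    + unfold cdist. rewrite Rminus_diag, fp_R0.
      eapply Rle_lt_trans; [apply Rmin_l | exact Heps].
    + rewrite right, cdist_frac_part, Rmult_1_l by lra.
      eapply Rle_lt_trans; [apply cdist_right; lra | lra].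
    + rewrite left, cdist_frac_part by lra.
      eapply Rle_lt_trans; [apply cdist_left; lra | lra].
Qed.

(** * The left-limit map *)

(* [h p] is the left limit of the right-continuous map [g] at [p]. *)
Definition left_limit_map (g h : R -> R) : Prop :=
  (forall p, unit_int p -> unit_int (g p) /\ unit_int (h p) /\
     germ 1 g p (g p) /\ germ (-1) g p (h p)) /\
  (forall p, ~ unit_int p -> g p = p /\ h p = p).

(** A translation preserves sides: points just left of [p] land just left of [h p], so left limits
    compose. *)
Lemma left_limit_map_iter (g h : R -> R) (n : nat) :
  left_limit_map g h -> left_limit_map (iter g n) (iter h n).
Proof.
  intros [inner outer]; split; intros p Hp; induction n as [|n IH]; simpl; auto.
  - repeat split; try apply Hp; exists 1; split; auto; lra.
  - destruct IH as (Hg & Hh & right & left).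
    destruct (inner _ Hg) as (Hg' & _ & right' & _), (inner _ Hh) as (_ & Hh' & _ & left').
    repeat split; try apply Hg'; try apply Hh'.
    + exact (germ_comp 1 g (iter g n) _ _ _ right right').
    + exact (germ_comp (-1) g (iter g n) _ _ _ left left').
  - destruct IH as [-> ->]; auto.
Qed.

(** On the circle, [x] is recovered from [h x] as the left limit there of the inverse [gi]. *)
Lemma left_limit_map_injective (g h gi : R -> R) (x y : R) :
  (forall u, gi (g u) = u) -> left_limit_map g h -> h x = h y -> x = y.
Proof.
  intros gig [inner outer] eq.
  destruct (classic (unit_int x)) as [Hx | Hx], (classic (unit_int y)) as [Hy | Hy].
  - apply (germ_unique (-1) gi (h x)); auto.
    + apply (germ_inverse _ g); [auto | apply inner; auto].
    + rewrite eq; apply (germ_inverse _ g); [auto | apply inner; auto].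
  - exfalso; apply Hy. destruct (outer y Hy) as [_ <-], (inner x Hx) as (_ & H & _). congruence.
  - exfalso; apply Hx. destruct (outer x Hx) as [_ <-], (inner y Hy) as (_ & H & _). congruence.
  - destruct (outer x Hx), (outer y Hy). congruence.
Qed.

Lemma left_limit_map_inverse (g h gi hi : R -> R) :
  (forall u, gi (g u) = u) -> (forall u, g (gi u) = u) ->
  (forall u, hi (h u) = u) -> (forall u, h (hi u) = u) ->
  left_limit_map g h -> left_limit_map gi hi.
Proof.
  intros gig ggi hih hhi [inner outer]; split; intros p Hp.
  - assert (Hg : unit_int (gi p)).
    { apply NNPP; intros H. destruct (outer _ H) as [e _]. rewrite ggi in e.
      apply H; now rewrite <- e. }
    assert (Hh : unit_int (hi p)).
    { apply NNPP; intros H. destruct (outer _ H) as [_ e]. rewrite hhi in e.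
      apply H; now rewrite <- e. }
    destruct (inner _ Hg) as (_ & _ & right & _), (inner _ Hh) as (_ & _ & _ & left).
    rewrite ggi in right; rewrite hhi in left.
    repeat split; try apply Hg; try apply Hh; now apply (germ_inverse _ g).
  - destruct (outer p Hp) as [eg eh]. rewrite <- eg at 1. rewrite <- eh at 3. auto.
Qed.

Lemma disc_count_left_limit_map (g h : R -> R) (l : list R) :
  left_limit_map g h -> NoDup l -> (forall p, In p l <-> g p <> h p) ->
  disc_count g (length l).
Proof.
  intros [inner outer] nd spec. exists l; split; [|split]; auto.
  intros p; rewrite spec. destruct (classic (unit_int p)) as [Hp | Hp].
  - destruct (inner p Hp) as (Hg & Hh & right & left).
    rewrite (continuous_iff_left_germ g p (h p)) by auto. tauto.
  - destruct (outer p Hp) as [-> ->]. tauto.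
Qed.

(** * Left limits of an interval exchange *)

Lemma locate_right (a : nat -> R) (k : nat) (x : R) :
  a 0%nat <= x < a k -> exists i, (i < k)%nat /\ a i <= x < a (S i).
Proof.
  induction k as [|k IH]; intros Hx; [lra|].
  destruct (Rlt_le_dec x (a k)) as [lt | le].
  - destruct IH as (i & Hi & H); [lra | exists i; auto].
  - exists k; split; [lia | lra].
Qed.

Lemma locate_left (a : nat -> R) (k : nat) (x : R) :
  a 0%nat < x <= a k -> exists i, (i < k)%nat /\ a i < x <= a (S i).
Proof.
  induction k as [|k IH]; intros Hx; [lra|].
  destruct (Rle_lt_dec x (a k)) as [le | lt].
  - destruct IH as (i & Hi & H); [lra | exists i; auto].
  - exists k; split; [lia | lra].
Qed.

Lemma partition_monotone (a : nat -> R) (k i j : nat) :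
  (forall i, (i < k)%nat -> a i < a (S i)) -> (i <= j <= k)%nat -> a i <= a j.
Proof.
  intros inc [le le']; induction le as [|j le IH]; [lra|].
  specialize (inc j); specialize (IH ltac:(lia)). specialize (inc ltac:(lia)). lra.
Qed.

Lemma IET_left_limit_map (f : R -> R) :
  is_IET f -> (forall x, ~ unit_int x -> f x = x) ->
  exists h D, left_limit_map f h /\ NoDup D /\ forall x, In x D <-> f x <> h x.
Proof.
  intros (range & _ & _ & k & a & t & a0 & ak & inc & trans) outer.
  assert (bounds : forall i, (i < k)%nat -> 0 <= a i /\ a (S i) <= 1).
  { intros i lt. rewrite <- a0, <- ak.
    split; apply (partition_monotone a k); auto; lia. }
  assert (right : forall p, unit_int p -> germ 1 f p (f p)).
  { intros p [p0 p1]. destruct (locate_right a k p) as (i & lt & Hi); [lra|].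
    destruct (bounds i lt). exists (a (S i) - p); split; [lra|]. intros s Hs.
    rewrite Rmult_1_l, (frac_part_unit (p + s)) by (split; lra).
    rewrite (trans i p), <- (frac_part_unit (f (p + s))), (trans i (p + s));
      auto; try lra.
    - f_equal; ring.
    - apply range; split; lra. }
  (* The last clause confines the disagreements of [f] and its left limit to the finitely many left
     endpoints. *)
  assert (left : forall p, exists y,
      (unit_int p -> unit_int y /\ germ (-1) f p y) /\ (~ unit_int p -> y = p) /\
      (~ In p (map a (seq 0 k)) -> y = f p)).
  { intros p. destruct (classic (unit_int p)) as [[p0 p1] | Hp].
    2:{ exists p; repeat split; intros; try contradiction; auto. symmetry; auto. }
    (* The point 0 is approached from the left along the last interval, as the point 1. *)
    assert (exists q (z : Z), 0 < q <= 1 /\ q = p + IZR z /\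
      (p <> 0 -> q = p)) as (q & z & Hq & Hz & Hqp).
    { destruct (Req_dec_T p 0).
      - exists 1, 1%Z; repeat split; lra.
      - exists p, 0%Z; repeat split; lra. }
    destruct (locate_left a k q) as (i & lt & Hi); [lra|].
    destruct (bounds i lt).
    (* The value [q + t i] may equal 1, which is the point 0 of the circle. *)
    exists (frac_part (q + t i)); split; [|split].
    - intros _; split; [apply unit_frac_part|].
      exists (q - a i); split; [lra|]. intros s Hs.
      rewrite (frac_part_unique (- z) (p + -1 * s) (q - s))
        by (rewrite ?opp_IZR; unfold unit_int; lra).
      rewrite frac_part_add_frac_part, <- (frac_part_unit (f (q - s))),
        (trans i (q - s)); auto; try lra.
      + f_equal; ring.
      + apply range; split; lra.
    - intros out; exfalso; apply out; split; lra.
    (* Here [p] turns out to be interior to its interval, so the left limit is the value. *)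
    - intros off.
      assert (nz : p <> 0).
      { intros e; apply off, in_map_iff; exists 0%nat; split; [lra|].
        apply in_seq. destruct k; [lra | lia]. }
      specialize (Hqp nz). subst q.
      assert (p <> a (S i)).
      { intros e. destruct (Nat.eq_dec (S i) k) as [ek | nk].
        - rewrite ek in e; lra.
        - apply off, in_map_iff; exists (S i); split; [lra | apply in_seq; lia]. }
      rewrite Hqp, <- (trans i p) by (auto; lra).
      apply frac_part_unit, range; split; lra. }
  exists (fun p => proj1_sig (constructive_indefinite_description _ (left p))).
  set (h := fun p => proj1_sig (constructive_indefinite_description _ (left p))).
  assert (h_spec : forall p,
      (unit_int p -> unit_int (h p) /\ germ (-1) f p (h p)) /\ (~ unit_int p -> h p = p) /\
      (~ In p (map a (seq 0 k)) -> h p = f p))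
    by (intros p; unfold h; apply proj2_sig).
  set (test := fun x => if Req_dec_T (f x) (h x) then false else true).
  exists (nodup Req_dec_T (filter test (map a (seq 0 k)))).
  split; [split | split; [apply NoDup_nodup|]].
  - intros p Hp. destruct (proj1 (h_spec p) Hp). auto.
  - intros p Hp. split; [auto | now apply h_spec].
  - intros x. rewrite nodup_In, filter_In; unfold test.
    destruct (Req_dec_T (f x) (h x)) as [eq | neq].
    + split; [intros [_ H]; discriminate H | tauto].
    + split; [tauto | intros _; split; [|reflexivity]].
      apply NNPP; intros H. apply neq; symmetry; now apply h_spec.
Qed.

(** * Extension by the identity *)

(** The given maps are arbitrary outside [[0,1)]. Making them the identity there yields inverse
    identities on all of [R], as the combinatorial part requires. *)
Definition extend_id (g : R -> R) (x : R) : R :=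
  if excluded_middle_informative (unit_int x) then g x else x.

Lemma extend_id_in (g : R -> R) (x : R) : unit_int x -> extend_id g x = g x.
Proof. unfold extend_id; now destruct excluded_middle_informative. Qed.

Lemma extend_id_out (g : R -> R) (x : R) : ~ unit_int x -> extend_id g x = x.
Proof. unfold extend_id; now destruct excluded_middle_informative. Qed.

Lemma extend_id_cancel (f g : R -> R) (x : R) :
  (forall x, unit_int x -> unit_int (f x)) -> (forall x, unit_int x -> g (f x) = x) ->
  extend_id g (extend_id f x) = x.
Proof.
  intros range cancel. destruct (classic (unit_int x)) as [Hx | Hx].
  - rewrite (extend_id_in f), extend_id_in; auto.
  - now rewrite (extend_id_out f), extend_id_out.
Qed.

Lemma iter_extend_id (g : R -> R) (n : nat) (x : R) :
  (forall x, unit_int x -> unit_int (g x)) -> unit_int x ->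
  unit_int (iter g n x) /\ iter (extend_id g) n x = iter g n x.
Proof.
  intros range Hx; induction n as [|n [IH1 IH2]]; simpl; auto.
  rewrite IH2, extend_id_in; auto.
Qed.

Lemma zpow_extend_id (f g : R -> R) (n : Z) (x : R) :
  (forall x, unit_int x -> unit_int (f x)) -> (forall x, unit_int x -> unit_int (g x)) ->
  unit_int x -> zpow (extend_id f) (extend_id g) n x = zpow f g n x.
Proof. intros; destruct n; simpl; auto; now apply iter_extend_id. Qed.

Lemma is_IET_extend_id (f : R -> R) : is_IET f -> is_IET (extend_id f).
Proof.
  intros (range & inj & surj & k & a & t & a0 & ak & inc & trans).
  split; [|split; [|split]].
  - intros x Hx; rewrite extend_id_in; auto.
  - intros x y Hx Hy; rewrite !extend_id_in; auto.
  - intros y Hy. destruct (surj y Hy) as (x & Hx & e).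
    exists x; rewrite extend_id_in; auto.
  - exists k, a, t; repeat split; auto. intros i x lt Hx. rewrite extend_id_in; auto.
    pose proof (partition_monotone a k 0 i inc ltac:(lia)).
    pose proof (partition_monotone a k (S i) k inc ltac:(lia)). split; lra.
Qed.

(** * Discontinuities of integer powers *)

Lemma disc_count_ext (g g' : R -> R) (m : nat) :
  (forall x, unit_int x -> g x = g' x) -> disc_count g m -> disc_count g' m.
Proof.
  intros eq (l & nd & len & spec). exists l; split; [|split]; auto.
  intros p; rewrite spec.
  assert (unit_int p -> (circ_continuous_at g p <-> circ_continuous_at g' p)); [|tauto].
  intros Hp; split; intros cont eps Heps;
    destruct (cont eps Heps) as (d & Hd & close); exists d; split; auto;
    intros x Hx near; specialize (close x Hx near);
    rewrite ?(eq x Hx), ?(eq p Hp) in *; auto.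
Qed.

Lemma zpow_disc_count (f g h hi : R -> R) (n : Z) (l : list R) :
  (forall x, g (f x) = x) -> (forall x, f (g x) = x) ->
  (forall x, hi (h x) = x) -> (forall x, h (hi x) = x) ->
  left_limit_map f h -> NoDup l ->
  (forall x, In x l <-> iter f (Z.abs_nat n) x <> iter h (Z.abs_nat n) x) ->
  disc_count (zpow f g n) (length l).
Proof.
  intros gf fg hih hhi llm nd spec. destruct n as [|p|p]; simpl in *.
  - apply (disc_count_left_limit_map _ (iter h 0)); auto.
    exact (left_limit_map_iter f h 0 llm).
  - apply (disc_count_left_limit_map _ (iter h (Pos.to_nat p))); auto.
    now apply left_limit_map_iter.
  - destruct (disagreements_inverse f g h hi (Pos.to_nat p) l gf fg hih hhi nd spec)
      as (l' & nd' & <- & spec').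
    apply (disc_count_left_limit_map _ (iter hi (Pos.to_nat p))); auto.
    apply left_limit_map_iter. now apply (left_limit_map_inverse f h).
Qed.

Theorem theorem1p1 (f finv : R -> R) :
  is_IET f ->
  (forall x, unit_int x -> finv (f x) = x /\ f (finv x) = x) ->
  (exists c : R, 0 < c /\ exists N : nat, forall n : Z, (N <= Z.abs_nat n)%nat ->
     exists m : nat, disc_count (zpow f finv n) m /\ c * IZR (Z.abs n) <= INR m)
  \/
  (exists B : nat, forall n : Z,
     exists m : nat, disc_count (zpow f finv n) m /\ (m <= B)%nat).
Proof.
  intros iet inverse.
  assert (range : forall x, unit_int x -> unit_int (f x)) by apply iet.
  assert (range_inv : forall x, unit_int x -> unit_int (finv x)).
  { intros y Hy. destruct iet as (_ & _ & surj & _), (surj y Hy) as (x & Hx & <-).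
    now rewrite (proj1 (inverse x Hx)). }
  assert (gf : forall x, extend_id finv (extend_id f x) = x)
    by (intros x; apply extend_id_cancel; auto; apply inverse).
  assert (fg : forall x, extend_id f (extend_id finv x) = x)
    by (intros x; apply extend_id_cancel; auto; apply inverse).
  destruct (IET_left_limit_map (extend_id f) (is_IET_extend_id f iet) (extend_id_out f))
    as (h & D & llm & nd & D_spec).
  assert (h_inj : forall x y, h x = h y -> x = y)
    by (intros x y; exact (left_limit_map_injective _ h _ x y gf llm)).
  assert (h_surj : forall y, exists x, h x = y)
    by (intros y; exact (h_surjective _ _ h D fg h_inj D_spec y nd)).
  set (hi := fun y => proj1_sig (constructive_indefinite_description _ (h_surj y))).
  assert (hhi : forall y, h (hi y) = y) by (intros y; unfold hi; apply proj2_sig).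
  assert (hih : forall x, hi (h x) = x) by (intros x; apply h_inj, hhi).
  assert (count : forall n : Z, exists l, NoDup l /\
    (forall x, In x l <->
       iter (extend_id f) (Z.abs_nat n) x <> iter h (Z.abs_nat n) x) /\
    disc_count (zpow f finv n) (length l)).
  { intros n. destruct (disagreements_finite _ _ h D gf D_spec (Z.abs_nat n))
      as (l & l_nd & l_spec).
    exists l; repeat split; try apply l_spec; auto.
    apply (disc_count_ext (zpow (extend_id f) (extend_id finv) n)).
    - intros x Hx; now apply zpow_extend_id.
    - now apply (zpow_disc_count _ _ h hi). }
  destruct (disagreements_linear_or_bounded _ _ h D gf fg h_inj D_spec)
    as [[M linear] | [B bounded]]; [left | right].
  (* Once [|n| >= 2 * M], the lower bound [|n| - M] is at least [|n| / 2]. *)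
  - exists (1 / 2); split; [lra|]. exists (2 * M)%nat. intros n le.
    destruct (count n) as (l & l_nd & l_spec & l_count).
    exists (length l); split; auto.
    specialize (linear (Z.abs_nat n) l ltac:(lia) l_spec).
    rewrite <- Zabs2Nat.id_abs, <- INR_IZR_INZ.
    assert (INR (Z.abs_nat n) <= INR (2 * length l)) as H by (apply le_INR; lia).
    rewrite mult_INR in H; simpl (INR 2) in H; lra.
  - exists B; intros n. destruct (count n) as (l & l_nd & l_spec & l_count).
    exists (length l); split; auto. exact (bounded _ l l_nd l_spec).
Qed.
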